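(* Let $\mathcal{A}=\{A_0,A_1,A_2\}$ be the standard basis of a symmetric rank $3$ standard integral table algebra with character table $[1,k,\ell;\,1,r,-1-r;\,1,s,-1-s]$. (i) If $k=r(2r+1)$, $\ell=(r-1)(2r+1)$ and $s=-r$, then the partition $2468|3579$ of $\{2,\dots,9\}$ gives a fusion of $\mathcal{A}\otimes\mathcal{A}$. (ii) If $k=(s+2)(2s+1)$, $\ell=(s+1)(2s+1)$ and $r=-2-s$, then the partition $2459|3768$ gives a fusion of $\mathcal{A}\otimes\mathcal{A}$.
   Context: A symmetric rank $3$ standard integral table algebra is a commutative associative complex algebra with basis $A_0=1,A_1,A_2$ such that the structure constants $\lambda_{ijh}$ ($A_iA_j=\sum_h\lambda_{ijh}A_h$) are nonnegative reals, $\lambda_{ij0}=0$ for $i\neq j$, and $\lambda_{ii0}=\delta(A_i)$ is a positive integer, where $\delta$ is the valency homomorphism. Main example: $A_0=I_n$, $A_1$ the adjacency matrix of a strongly regular graph, $A_2=J-I-A_1$. Here $k=\delta(A_1)$, $\ell=\delta(A_2)$, and the character table has rows the characters $\chi_0=\delta,\chi_1,\chi_2$ and columns $A_0,A_1,A_2$. The tensor square $\mathcal{A}\otimes\mathcal{A}$ has basis $A_{ij}=A_i\otimes A_j$, relabelled $C_{3j+i+1}=A_{ij}$: $C_1=A_{00},C_2=A_{10},C_3=A_{20},C_4=A_{01},C_5=A_{11},C_6=A_{21},C_7=A_{02},C_8=A_{12},C_9=A_{22}$. Partitions of $\{2,\dots,9\}$ are written with blocks separated by bars. A partition $\tau$ gives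 a fusion of $\mathcal{A}\otimes\mathcal{A}$ if the span of $C_1$ and the block sums $\sum_{t\in T}C_t$ ($T$ a block of $\tau$) is closed under multiplication. *)

(* Defs.v *)
From HB Require Import structures.
From mathcomp Require Import all_boot all_order all_algebra all_field.
From mathcomp Require Import complex reals.

Set Implicit Arguments.
Unset Strict Implicit.
Unset Printing Implicit Defensive.

Import Order.TTheory GRing.Theory Num.Theory.

Local Open Scope ring_scope.

(* The tensor product A ⊗ B of two finite-dimensional algebras, as the space  *)
(* of coordinate matrices on the products of the vectors of the library's     *)
(* chosen bases of A and B.  [tensM] and [tensor_ind] below show that the     *)
(* product is the usual one; [tensor_univ] is the universal property.         *)
Section Tensor.

Variables (K : fieldType) (A B : falgType K).

Definition tensor : Type := 'M[K]_(\dim {:A}, \dim {:B}).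

HB.instance Definition _ := Vector.on tensor.

Definition tens (a : A) (b : B) : tensor :=
  \matrix_(i, j) (coord (vbasis {:A}) i a * coord (vbasis {:B}) j b).

Let e := vbasis {:A}.
Let f := vbasis {:B}.

Definition tensor_mul (X Y : tensor) : tensor :=
  \sum_i \sum_j \sum_p \sum_q
     (X i j * Y p q) *: tens (e`_i * e`_p) (f`_j * f`_q).

Lemma tensDl a a' b : tens (a + a') b = tens a b + tens a' b.
Proof. by apply/matrixP=> i j; rewrite !mxE linearD mulrDl. Qed.

Lemma tensDr a b b' : tens a (b + b') = tens a b + tens a b'.
Proof. by apply/matrixP=> i j; rewrite !mxE linearD mulrDr. Qed.

Lemma tensZl c a b : tens (c *: a) b = c *: tens a b.
Proof. by apply/matrixP=> i j; rewrite !mxE linearZ -mulrA. Qed.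

Lemma tensZr c a b : tens a (c *: b) = c *: tens a b.
Proof. by apply/matrixP=> i j; rewrite !mxE linearZ mulrCA. Qed.

Lemma tens0l b : tens 0 b = 0.
Proof. by rewrite -(scale0r 0) tensZl scale0r. Qed.

Lemma tens0r a : tens a 0 = 0.
Proof. by rewrite -(scale0r 0) tensZr scale0r. Qed.

Lemma tens_suml I (r : seq I) (P : pred I) (F : I -> A) b :
  tens (\sum_(i <- r | P i) F i) b = \sum_(i <- r | P i) tens (F i) b.
Proof.
by apply: (big_morph (tens^~ b)) => [x y|]; rewrite ?tensDl ?tens0l.
Qed.

Lemma tens_sumr I (r : seq I) (P : pred I) (F : I -> B) a :
  tens a (\sum_(i <- r | P i) F i) = \sum_(i <- r | P i) tens a (F i).
Proof.
by apply: (big_morph (tens a)) => [x y|]; rewrite ?tensDr ?tens0r.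
Qed.

Lemma tens_basis (i : 'I_(\dim {:A})) (j : 'I_(\dim {:B})) :
  tens e`_i f`_j = delta_mx i j.
Proof.
have fe : free e by apply: basis_free (vbasisP _).
have ff : free f by apply: basis_free (vbasisP _).
by apply/matrixP=> p q; rewrite !mxE !coord_free // -natrM mulnb
  (eq_sym i) (eq_sym j).
Qed.

Lemma tensorE (X : tensor) : X = \sum_i \sum_j X i j *: tens e`_i f`_j.
Proof.
rewrite [LHS]matrix_sum_delta; apply: eq_bigr => i _; apply: eq_bigr => j _.
by rewrite tens_basis.
Qed.

Lemma tensor_ind (P : tensor -> Prop) :
    P 0 -> (forall X Y, P X -> P Y -> P (X + Y)) -> (forall a b, P (tens a b)) ->
  forall X, P X.
Proof.
move=> P0 PD Pt X; rewrite [X]tensorE.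
by do 2!(apply: big_ind => // ? _); rewrite -tensZl.
Qed.

Lemma tensor_mulDl X Y Z :
  tensor_mul (X + Y) Z = tensor_mul X Z + tensor_mul Y Z.
Proof.
rewrite -!big_split; apply: eq_bigr => i _; rewrite -!big_split.
apply: eq_bigr => j _; rewrite -!big_split; apply: eq_bigr => p _.
rewrite -!big_split; apply: eq_bigr => q _.
by rewrite mxE mulrDl scalerDl.
Qed.

Lemma tensor_mulDr X Y Z :
  tensor_mul X (Y + Z) = tensor_mul X Y + tensor_mul X Z.
Proof.
rewrite -!big_split; apply: eq_bigr => i _; rewrite -!big_split.
apply: eq_bigr => j _; rewrite -!big_split; apply: eq_bigr => p _.
rewrite -!big_split; apply: eq_bigr => q _.
by rewrite mxE mulrDr scalerDl.
Qed.

Lemma tensor_mulZl c X Y : tensor_mul (c *: X) Y = c *: tensor_mul X Y.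
Proof.
rewrite /tensor_mul.
by do 4!(rewrite scaler_sumr; apply: eq_bigr => ? _); rewrite mxE scalerA mulrA.
Qed.

Lemma tensor_mulZr c X Y : tensor_mul X (c *: Y) = c *: tensor_mul X Y.
Proof.
rewrite /tensor_mul.
by do 4!(rewrite scaler_sumr; apply: eq_bigr => ? _); rewrite mxE scalerA mulrCA.
Qed.

Lemma tensor_mul_tens a b a' b' :
  tensor_mul (tens a b) (tens a' b') = tens (a * a') (b * b').
Proof.
have ea x : x = \sum_i coord e i x *: e`_i by apply/coord_vbasis/memvf.
have fb x : x = \sum_i coord f i x *: f`_i by apply/coord_vbasis/memvf.
rewrite [in RHS](ea a) mulr_suml tens_suml; apply: eq_bigr => i _.
rewrite [in RHS](fb b) mulr_suml tens_sumr; apply: eq_bigr => j _.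
rewrite [in RHS](ea a') mulr_sumr tens_suml; apply: eq_bigr => p _.
rewrite [in RHS](fb b') mulr_sumr tens_sumr; apply: eq_bigr => q _.
rewrite !mxE -!scalerAl -!scalerAr !tensZl !tensZr !scalerA; congr (_ *: _).
by rewrite -!mulrA; congr (_ * _); rewrite mulrCA.
Qed.

Lemma tensor_mul0l X : tensor_mul 0 X = 0.
Proof. by rewrite -(scale0r 0) tensor_mulZl !scale0r. Qed.

Lemma tensor_mul0r X : tensor_mul X 0 = 0.
Proof. by rewrite -(scale0r 0) tensor_mulZr !scale0r. Qed.

Lemma tensor_mulA : associative tensor_mul.
Proof.
move=> X Y Z; elim/tensor_ind: X => [|X X' IX IX'|a b].
- by rewrite !tensor_mul0l.
- by rewrite !tensor_mulDl IX IX'.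
elim/tensor_ind: Y => [|Y Y' IY IY'|a' b'].
- by rewrite !(tensor_mul0l, tensor_mul0r).
- by rewrite !(tensor_mulDl, tensor_mulDr) IY IY'.
elim/tensor_ind: Z => [|Z Z' IZ IZ'|a'' b''].
- by rewrite !tensor_mul0r.
- by rewrite !tensor_mulDr IZ IZ'.
by rewrite !tensor_mul_tens !mulrA.
Qed.

Lemma tensor_mul1l : left_id (tens 1 1) tensor_mul.
Proof.
elim/tensor_ind=> [|X Y IX IY|a b]; first exact: tensor_mul0r.
  by rewrite tensor_mulDr IX IY.
by rewrite tensor_mul_tens !mul1r.
Qed.

Lemma tensor_mul1r : right_id (tens 1 1) tensor_mul.
Proof.
elim/tensor_ind=> [|X Y IX IY|a b]; first exact: tensor_mul0l.
  by rewrite tensor_mulDl IX IY.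
by rewrite tensor_mul_tens !mulr1.
Qed.

Lemma tens_eq0 a b : (tens a b == 0) = (a == 0) || (b == 0).
Proof.
apply/idP/idP=> [/eqP t0|/orP[]/eqP->]; rewrite ?tens0l ?tens0r //.
apply/norP=> -[/negP a0 /negP b0].
case: (pickP (fun i => coord e i a != 0)) => [i ai|a_0]; last first.
  apply: a0; rewrite (coord_vbasis (memvf a)) big1 // => i _.
  by have /negbFE/eqP-> := a_0 i; rewrite scale0r.
case: (pickP (fun i => coord f i b != 0)) => [j bj|b_0]; last first.
  apply: b0; rewrite (coord_vbasis (memvf b)) big1 // => j _.
  by have /negbFE/eqP-> := b_0 j; rewrite scale0r.
move/matrixP/(_ i j)/eqP: t0; rewrite !mxE mulf_eq0.
by rewrite (negPf ai) (negPf bj).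
Qed.

Lemma tensor1_neq0 : tens 1 1 != 0.
Proof. by rewrite tens_eq0 !oner_eq0. Qed.

HB.instance Definition _ := GRing.Zmodule_isNzRing.Build tensor
  tensor_mulA tensor_mul1l tensor_mul1r tensor_mulDl tensor_mulDr tensor1_neq0.

Lemma tensor_scalerAl c (X Y : tensor) : c *: (X * Y) = (c *: X) * Y.
Proof. by rewrite [RHS]tensor_mulZl. Qed.

HB.instance Definition _ :=
  GRing.Lmodule_isLalgebra.Build K tensor tensor_scalerAl.

Lemma tensor_scalerAr c (X Y : tensor) : c *: (X * Y) = X * (c *: Y).
Proof. by rewrite [RHS]tensor_mulZr. Qed.

HB.instance Definition _ :=
  GRing.Lalgebra_isAlgebra.Build K tensor tensor_scalerAr.

HB.instance Definition _ := Algebra_isFalgebra.Build K tensor.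

Lemma tensM a b a' b' : tens a b * tens a' b' = tens (a * a') (b * b').
Proof. exact: tensor_mul_tens. Qed.

Lemma tens11 : tens 1 1 = 1.
Proof. by []. Qed.

Lemma tensor_univ (V : lmodType K) (g : A -> B -> V) :
    (forall b, linear (g^~ b)) -> (forall a, linear (g a)) ->
  exists h : {linear tensor -> V}, forall a b, h (tens a b) = g a b.
Proof.
move=> gl gr.
pose h (X : tensor) : V := \sum_i \sum_j X i j *: g e`_i f`_j.
have h_lin : linear h.
  move=> c X Y; rewrite /h scaler_sumr -big_split; apply: eq_bigr => i _.
  rewrite scaler_sumr -big_split; apply: eq_bigr => j _.
  by rewrite !mxE scalerDl scalerA.
pose hM := GRing.isLinear.Build K tensor V *:%R h h_lin.
pose hL : {linear tensor -> V} := HB.pack h hM.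
exists hL => a b; rewrite /= /h.
pose gla b0 := GRing.isLinear.Build K A V *:%R (g^~ b0) (gl b0).
pose gL b0 : {linear A -> V} := HB.pack (g^~ b0) (gla b0).
pose gra a0 := GRing.isLinear.Build K B V *:%R (g a0) (gr a0).
pose gR a0 : {linear B -> V} := HB.pack (g a0) (gra a0).
rewrite -[g a b]/(gL b a) {2}(coord_vbasis (memvf a)) linear_sum.
apply: eq_bigr => i _; rewrite linearZ /= -[g _ b]/(gR _ b).
rewrite {2}(coord_vbasis (memvf b)) linear_sum scaler_sumr.
by apply: eq_bigr => j _; rewrite linearZ !mxE scalerA.
Qed.

End Tensor.

Section TableAlgebra.

Variables (R : realType) (A : falgType R[i]).

Definition struct_const (a : 3.-tuple A) (i j h : 'I_3) : R[i] :=
  coord a h (a`_i * a`_j).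

(* [0 <= z] in R[i] means that z is a nonnegative real number. *)
Record symmetric_standard_integral_table_algebra
    (a : 3.-tuple A) (delta : {lrmorphism A -> R[i]^o}) : Prop := {
  ta_mulC : commutative (@GRing.mul A);
  ta_basis : basis_of {:A} a;
  ta_one : a`_0 = 1;
  ta_ge0 : forall i j h, 0 <= struct_const a i j h;
  ta_orth : forall i j, i != j -> struct_const a i j 0 = 0;
  ta_std : forall i, struct_const a i i 0 = delta a`_i;
  ta_int : forall i : 'I_3, exists2 n : nat, (0 < n)%N & delta a`_i = n%:R
}.

(* As A is commutative, its irreducible characters are the algebra            *)
(* homomorphisms A -> R[i].                                                   *)
Definition is_character_table (a : 3.-tuple A)
    (delta : {lrmorphism A -> R[i]^o}) (P : 'M[R[i]]_3) : Prop :=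
  exists chi : 'I_3 -> {lrmorphism A -> R[i]^o},
    [/\ chi 0 =1 delta,
        forall i j, chi i =1 chi j -> i = j,
        forall psi : {lrmorphism A -> R[i]^o}, exists i, psi =1 chi i
      & forall i j, P i j = chi i a`_j].

(* C_{3j+i+1} = A_i ⊗ A_j, for labels between 1 and 9. *)
Definition tensor_label (a : 3.-tuple A) (t : nat) : tensor A A :=
  tens a`_(t.-1 %% 3) a`_(t.-1 %/ 3).

Definition fusion_space (a : 3.-tuple A) (tau : {set {set 'I_10}}) :
    {vspace tensor A A} :=
  (<[tensor_label a 1%N]>
   + \sum_(T in tau) <[\sum_(t in T) tensor_label a t]>)%VS.

Definition gives_fusion (a : 3.-tuple A) (tau : {set {set 'I_10}}) : Prop :=
  partition tau [set t : 'I_10 | (2 <= t)%N] /\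
  (forall x y, x \in fusion_space a tau -> y \in fusion_space a tau ->
     x * y \in fusion_space a tau).

End TableAlgebra.

Definition block (s : seq nat) : {set 'I_10} := [set t : 'I_10 | val t \in s].

Definition rank3_table (R : realType) (k l r s : R[i]) : 'M[R[i]]_3 :=
  \matrix_(i, j)
    nth 0 (nth [::] [:: [:: 1; k; l];
                        [:: 1; r; -1 - r];
                        [:: 1; s; -1 - s]] i) j.

(* Main.v *)
(** The three characters separate the points of [A], so the products of [A]
    can be read off the character table.  In case (i), with [J = A_0 + A_1 + A_2]
    and [X = A_1], this gives [X^2 = r^2 + (r^2 + r) J], [X J = r (2 r + 1) J] and
    [J^2 = 4 r^2 J].  The block 2468 has sum [B = X ⊗ (J - X) + (J - X) ⊗ X], and
    the fusion space is spanned by [1], [B] and [J ⊗ J]; the relations give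
    [B^2 = 4 r^4 + (4 r^4 - 2 r^2) J ⊗ J].  Case (ii) is case (i)
    for the swapped basis [A_0, A_2, A_1], with [-1 - s] in place of [r]. *)

Require Import Defs.
From mathcomp Require Import all_boot all_order all_algebra all_field.
From mathcomp Require Import complex reals ring.

Set Implicit Arguments.
Unset Strict Implicit.
Unset Printing Implicit Defensive.

Import Order.TTheory GRing.Theory Num.Theory.

Local Open Scope ring_scope.

(** * Closure of a three-dimensional span under multiplication *)

Section SpanClosed.

Variables (K : fieldType) (E : falgType K).

Lemma memv_line_add3 (u v w x : E) :
  reflect (exists c : K * K * K, x = c.1.1 *: u + c.1.2 *: v + c.2 *: w)
          (x \in (<[u]> + (<[v]> + <[w]>))%VS).
Proof.
apply: (iffP idP) => [|[[[c d] e] ->] /=]; last first.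
  by rewrite -addrA !memv_add ?memvZ ?memv_line.
case/memv_addP=> _ /vlineP[c ->] [vw /memv_addP vw_in ->].
have [_ /vlineP[d ->] [_ /vlineP[e ->] ->]] := vw_in.
by exists (c, d, e); rewrite addrA.
Qed.

(** As [b' = j - 1 - b], the span is also that of [1], [b] and [j], whose products are prescribed.
    Both [b * j] and [j * b] occur because [E] may be noncommutative. *)
Lemma span3_mul_closed (b b' j : E) (c d e f : K) :
    1 + b + b' = j -> b * b = c *: 1 + d *: j -> b * j = e *: j ->
    j * b = e *: j -> j * j = f *: j ->
  let U := (<[1]> + (<[b]> + <[b']>))%VS in
  {in U &, forall x y, x * y \in U}.
Proof.
move=> def_j bb bj jb jj U.
have U1 : 1 \in U by rewrite (subvP (addvSl _ _)) ?memv_line.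
have Ub : b \in U.
  by rewrite (subvP (addvSr _ _)) // (subvP (addvSl _ _)) ?memv_line.
have Ub' : b' \in U.
  by rewrite (subvP (addvSr _ _)) // (subvP (addvSr _ _)) ?memv_line.
have Uj : j \in U by rewrite -def_j !rpredD.
have def_b' : b' = j - (1 + b) by rewrite -def_j addrC addKr.
move=> _ _ /memv_line_add3[[[p q] o] /= ->] /memv_line_add3[[[p' q'] o'] /= ->].
rewrite def_b' !(mulrDl, mulrDr) -!scalerAl -!scalerAr.
rewrite !(mulrDl, mulrDr, mulrN, mulNr, mulr1, mul1r) bb bj jb jj.
by rewrite !(rpredD, rpredN, rpredZ).
Qed.

End SpanClosed.

(** * Relations in the tensor square *)

Section TensorSquare.

Variables (K : fieldType) (A : falgType K) (X J : A) (t : K).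
Hypotheses (XX : X * X = t ^+ 2 *: 1 + (t ^+ 2 + t) *: J)
  (XJ : X * J = (t * (2 * t + 1)) *: J) (JX : J * X = (t * (2 * t + 1)) *: J)
  (JJ : J * J = (4 * t ^+ 2) *: J).

Let B : tensor A A := tens X (J - X) + tens (J - X) X.

(** Since [(J - X) J = t (2 t - 1) J], each of the two summands of [B] multiplies [J ⊗ J] by
    [t (2 t + 1) t (2 t - 1)]. *)
Lemma swap_tens_mulJ :
  B * tens J J = (2 * t ^+ 2 * (4 * t ^+ 2 - 1)) *: tens J J.
Proof.
(* Entries of a pure tensor are products of coordinates, so the tensor identity becomes a polynomial
   one. *)
rewrite /B mulrDl !tensM !mulrBl JJ XJ; apply/matrixP=> i j.
by rewrite /tens !mxE !(linearB, linearZ) /=; ring.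
Qed.

Lemma swap_tens_mulJl :
  tens J J * B = (2 * t ^+ 2 * (4 * t ^+ 2 - 1)) *: tens J J.
Proof.
rewrite /B mulrDr !tensM !mulrBr JJ JX; apply/matrixP=> i j.
by rewrite /tens !mxE !(linearB, linearZ) /=; ring.
Qed.

(** Put [Y = J - X]. Then [Y^2 = t^2 + (t^2 - t) J] and [X Y = Y X = t^2 (J - 1)]. In
    [X^2 ⊗ Y^2 + Y^2 ⊗ X^2 + 2 (X Y ⊗ X Y)] the terms in [1 ⊗ J] and [J ⊗ 1] cancel. *)
Lemma swap_tens_sqr :
  B * B = (4 * t ^+ 4) *: 1 + (4 * t ^+ 4 - 2 * t ^+ 2) *: tens J J.
Proof.
rewrite -tens11 /B mulrDl !mulrDr !tensM !(mulrBl, mulrBr) XX XJ JX JJ.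
apply/matrixP=> i j; rewrite /tens !mxE !(linearB, linearD, linearZ) /=.
by ring.
Qed.

Lemma swap_tens_span_closed (B' : tensor A A) :
    1 + B + B' = tens J J ->
  let U := (<[1%R]> + (<[B]> + <[B']>))%VS in
  {in U &, forall x y, x * y \in U}.
Proof.
move=> defJ; apply: (span3_mul_closed defJ swap_tens_sqr swap_tens_mulJ).
  exact: swap_tens_mulJl.
by rewrite tensM JJ tensZl tensZr scalerA.
Qed.

End TensorSquare.

(** * Invertibility of the character table *)

(** The last two rows of the table sum to 0 and the first to [1 + k + l], so its determinant is
    [(1 + k + l) (s - r)]. *)
Lemma rank3_table_kernel (F : fieldType) (k l r s x y z : F) :
    r != s -> 1 + k + l != 0 ->
    x + (y * k + z * l) = 0 -> x + (y * r + z * (-1 - r)) = 0 ->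
    x + (y * s + z * (-1 - s)) = 0 ->
  [/\ x = 0, y = 0 & z = 0].
Proof.
rewrite -subr_eq0 => rs /mulfI nI e0 e1 e2.
have yz : y = z.
  apply/eqP; rewrite -subr_eq0; apply/eqP/(mulfI rs); rewrite mulr0.
  by rewrite -[RHS](subrr 0) -{1}e1 -e2; ring.
have xz : x = z.
  by apply/eqP; rewrite -subr_eq0; apply/eqP; rewrite -[RHS]e1 yz; ring.
have z0 : z = 0 by apply: nI; rewrite mulr0 -e0 yz xz; ring.
by rewrite xz yz z0.
Qed.

Section Table.

Variables (R : realType) (A : falgType R[i]) (a : 3.-tuple A).
Variables (delta : {lrmorphism A -> R[i]^o}) (k l r s : R[i]).
Hypotheses (hA : symmetric_standard_integral_table_algebra a delta)
  (hP : is_character_table a delta (rank3_table k l r s)).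

(** The coordinates of an element killed by all characters lie in the kernel of the table. This
    kernel is zero: [r = s] would identify two distinct characters, and [1 + k + l] is a positive
    integer. *)
Lemma table_characters_separate :
  exists2 chi : 'I_3 -> {lrmorphism A -> R[i]^o},
    forall (i j : 'I_3), chi i a`_j = rank3_table k l r s i j
  & forall x y, (forall i, chi i x = chi i y) -> x = y.
Proof.
case: hP => chi [chi0 chi_inj _ chiE]; exists chi => // x y eq_xy.
have coordE z : z = \sum_i coord a i z *: a`_i.
  by apply: coord_basis (memvf z); apply: ta_basis hA.
have chi_coord i z : chi i z = \sum_j coord a j z * rank3_table k l r s i j.
  rewrite [in LHS](coordE z) linear_sum; apply: eq_bigr => j _.
  by rewrite linearZ chiE.
have rs : r != s.
  apply/eqP=> eq_rs; have /eqP : 1 = 2%:R :> 'I_3; last by [].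
  apply: chi_inj => z; rewrite !chi_coord; apply: eq_bigr => j _.
  by rewrite !mxE eq_rs.
have n_neq0 : 1 + k + l != 0.
  have [m _ km] := ta_int hA 1; have [m' _ lm] := ta_int hA 2%:R.
  have := chiE 0 1; have := chiE 0 2%:R; rewrite !chi0 km lm !mxE /= => -> ->.
  by rewrite nat1r -natrD pnatr_eq0.
apply/eqP; rewrite -subr_eq0; apply/eqP.
have chi_z i : chi i (x - y) = 0 by rewrite rmorphB /= eq_xy subrr.
move: (x - y) chi_z => z chi_z.
have := chi_z 0; have := chi_z 1; have := chi_z 2%:R.
rewrite [z in z = 0 :> A]coordE !chi_coord !big_ord_recl !big_ord0 !mxE /=.
rewrite !addr0 !mulr1.
move=> e2 e1 e0; have [-> -> ->] := rank3_table_kernel rs n_neq0 e0 e1 e2.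
by rewrite !scale0r !add0r.
Qed.

End Table.

(** * Two-block partitions of the labels and their fusion spaces *)

Lemma partition_set2 (T : finType) (S S' D : {set T}) :
    S != set0 -> S' != set0 -> [disjoint S & S'] -> S :|: S' = D ->
  partition [set S; S'] D.
Proof.
move=> S0 S'0 dSS' defD; rewrite /partition; apply/and3P; split.
- by rewrite -defD /cover bigcup_setU !big_set1.
- apply/trivIsetP=> U V /set2P[]-> /set2P[]->; rewrite ?eqxx //.
  by rewrite disjoint_sym.
- by rewrite !inE !(eq_sym set0) (negPf S0).
Qed.

Lemma block_disjoint (p q : seq nat) :
  uniq (p ++ q) -> [disjoint block p & block q].
Proof.
rewrite cat_uniq => /and3P[_ /hasPn pq _].
rewrite -setI_eq0; apply/eqP/setP=> t; rewrite !inE; apply/andP=> -[tp tq].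
by have := pq _ tq; rewrite /= tp.
Qed.

Lemma block_partition (p q : seq nat) :
    perm_eq (p ++ q) (iota 2 8) -> p != [::] -> q != [::] ->
  partition [set block p; block q] [set t : 'I_10 | (2 <= t)%N].
Proof.
move=> pq p0 q0.
have mem_pq n : (n \in p ++ q) = (2 <= n < 10)%N.
  by rewrite (perm_mem pq) mem_iota.
have block_neq0 (u : seq nat) :
    {subset u <= p ++ q} -> u != [::] -> block u != set0.
  case: u => // n u sub _; have := sub n (mem_head _ _).
  rewrite mem_pq => /andP[_ n10]; apply/set0Pn; exists (Ordinal n10).
  by rewrite inE mem_head.
apply: partition_set2.
- by apply: block_neq0 => // n np; rewrite mem_cat np.
- by apply: block_neq0 => // n nq; rewrite mem_cat nq orbT.
- by apply: block_disjoint; rewrite (perm_uniq pq) iota_uniq.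
- by apply/setP=> t; rewrite !inE -mem_cat mem_pq ltn_ord andbT.
Qed.

(** Block sums become sums over explicit lists, which unfold term by term. *)
Lemma big_block (V : nmodType) (u : seq nat) (F : nat -> V) :
    uniq u -> all (fun n => n < 10)%N u ->
  \sum_(t in block u) F t = \sum_(n <- u) F n.
Proof.
move=> Uu /allP u10; rewrite (eq_bigl (fun t : 'I_10 => val t \in u)).
  rewrite -(big_mkord (mem u) F) -big_filter; apply: perm_big.
  apply: uniq_perm; rewrite ?filter_uniq ?iota_uniq // => n.
  rewrite mem_filter mem_index_iota /=.
  by case: (boolP (n \in u)) => // /u10 ->.
by move=> t; rewrite inE.
Qed.

Lemma block_fusion (R : realType) (A : falgType R[i]) (a : 3.-tuple A)
    (p q : seq nat) (X J : A) (t : R[i]) :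
    perm_eq (p ++ q) (iota 2 8) -> p != [::] -> q != [::] ->
    a`_0 = 1 -> J = a`_0 + a`_1 + a`_2 ->
    X * X = t ^+ 2 *: 1 + (t ^+ 2 + t) *: J ->
    X * J = (t * (2 * t + 1)) *: J -> J * X = (t * (2 * t + 1)) *: J ->
    J * J = (4 * t ^+ 2) *: J ->
    \sum_(n <- p) tensor_label a n = tens X (J - X) + tens (J - X) X ->
  gives_fusion a [set block p; block q].
Proof.
move=> pq p0 q0 a0 defJ XX XJ JX JJ sum_p.
have part := block_partition pq p0 q0; split=> //.
have Upq : uniq (p ++ q) by rewrite (perm_uniq pq) iota_uniq.
have pq10 : all (fun n => n < 10)%N (p ++ q).
  by apply/allP=> n; rewrite (perm_mem pq) mem_iota => /andP[].
have dpq := block_disjoint Upq.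
move: Upq pq10; rewrite cat_uniq all_cat => /and3P[Up _ Uq] /andP[p10 q10].
(* The sum over the set of blocks has two terms only if the blocks differ; equal disjoint blocks
   would be empty. *)
have bpq : block p \notin [set block q].
  rewrite inE; apply: contraL (partition_neq0 part (set21 _ _)) => /eqP Epq.
  by move: dpq; rewrite -Epq -setI_eq0 setIid negbK.
rewrite /fusion_space big_setU1 //= big_set1 !big_block // sum_p.
have -> : tensor_label a 1 = 1 by rewrite /tensor_label /= a0 tens11.
apply: (swap_tens_span_closed XX XJ JX JJ).
(* With the unit as label 1, all nine labels together sum to [J ⊗ J], so the second block sum needs
   no separate computation. *)
rewrite -sum_p -addrA -big_cat (perm_big _ pq) -tens11 -a0 defJ /=.
rewrite !big_cons big_nil /tensor_label /=; apply/matrixP=> i j.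
by rewrite /tens !mxE !linearD /=; ring.
Qed.

(** * The two fusions *)

Theorem theorem4p7 (R : realType) (A : falgType R[i]) (a : 3.-tuple A)
    (delta : {lrmorphism A -> R[i]^o}) (k l r s : R[i])
    (hA : symmetric_standard_integral_table_algebra a delta)
    (hP : is_character_table a delta (rank3_table k l r s)) :
  (k = r * (2 * r + 1) -> l = (r - 1) * (2 * r + 1) -> s = - r ->
     gives_fusion a [set block [:: 2; 4; 6; 8]%N; block [:: 3; 5; 7; 9]%N]) /\
  (k = (s + 2) * (2 * s + 1) -> l = (s + 1) * (2 * s + 1) -> r = - 2 - s ->
     gives_fusion a [set block [:: 2; 4; 5; 9]%N; block [:: 3; 7; 6; 8]%N]).
Proof.
have [chi chiE chi_sep] := table_characters_separate hA hP.
have [a0 mulC] := (ta_one hA, ta_mulC hA).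
have [chi0 chi1 chi2] :
  [/\ forall i, chi i a`_0 = 1,
      forall i, chi i a`_1 = [:: k; r; s]`_i
    & forall i, chi i a`_2 = [:: l; -1 - r; -1 - s]`_i].
  split=> i; first by rewrite a0 rmorph1.
    by rewrite (chiE i 1) mxE; case: i => [[|[|[]]]].
  by rewrite (chiE i 2%:R) mxE; case: i => [[|[|[]]]].
have chiZ i c x : chi i (c *: x) = c * chi i x by rewrite linearZ.
pose J := a`_0 + a`_1 + a`_2.
(* Nonprincipal characters kill [J], so relations between multiples of [J] need checking only at
   [chi 0]. *)
have chiJ i : chi i J = [:: 1 + k + l; 0; 0]`_i.
  rewrite !rmorphD /= chi0 chi1 chi2.
  by case: i => [[|[|[]]]] //= ?; ring.
(* Common to both cases: [b] plays the part of [X]. At a nonprincipal character the relation for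
   [X^2] reduces to the value of [b] having square [t^2]. *)
have fusion (p q : seq nat) (b : A) (t : R[i]) :
    perm_eq (p ++ q) (iota 2 8) -> p != [::] -> q != [::] ->
    1 + k + l = 4 * t ^+ 2 -> chi 0 b = t * (2 * t + 1) ->
    (forall i, i != 0 -> chi i b * chi i b = t ^+ 2) ->
    \sum_(n <- p) tensor_label a n = tens b (J - b) + tens (J - b) b ->
  gives_fusion a [set block p; block q].
  move=> pq p0 q0 nE chi_b0 chi_b; have bJ : b * J = (t * (2 * t + 1)) *: J.
    apply: chi_sep => i; rewrite rmorphM /= chiZ chiJ.
    have [-> | i0] := eqVneq i 0; first by rewrite chi_b0.
    by move: i0; case: i => [[|[|[]]]] //= ? _; rewrite !mulr0.
  apply: (block_fusion (t := t) (J := J)) => //.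
  - apply: chi_sep => i; rewrite rmorphM rmorphD /= !chiZ rmorph1 chiJ.
    have [-> | i0] := eqVneq i 0; first by rewrite chi_b0 /= nE; ring.
    rewrite chi_b //; move: i0; case: i => [[|[|[]]]] //= ? _; ring.
  - by rewrite mulC.
  - apply: chi_sep => i; rewrite rmorphM /= chiZ chiJ -nE.
    by case: i => [[|[|[]]]] //= ?; rewrite !mulr0.
split=> [kE lE sE | kE lE rE].
  (* The nonprincipal values of [A_1] are [r] and [-r], and
     [1 + k + l = 1 + (2 r - 1) (2 r + 1)]. *)
  apply: (fusion _ _ a`_1 r) => //.
  - by rewrite kE lE; ring.
  - by rewrite chi1.
  - by move=> i; rewrite chi1; case: i => [[|[|[]]]] //= ? _; rewrite ?sE; ring.
  - rewrite !big_cons big_nil /J /tensor_label /=; apply/matrixP=> i j.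
    by rewrite /tens !mxE !(linearB, linearD) /=; ring.
(* For [t = -1 - s] the nonprincipal values of [A_2] are [-t] and [t], and [l = t (2 t + 1)]. The
   block of [A_2 ⊗ (J - A_2) + (J - A_2) ⊗ A_2] is 3768, hence the swap. *)
rewrite setUC; apply: (fusion _ _ a`_2 (- 1 - s)) => //.
- by rewrite kE lE; ring.
- by rewrite chi2 /= lE; ring.
- by move=> i; rewrite chi2; case: i => [[|[|[]]]] //= ? _; rewrite ?rE; ring.
- rewrite !big_cons big_nil /J /tensor_label /=; apply/matrixP=> i j.
  by rewrite /tens !mxE !(linearB, linearD) /=; ring.
Qed.
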